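(* Let $G$ be a two-edge-connected graph with vertex set $[n]$, and let $e_i$ and $e_j$ be two (not necessarily distinct) edges of $G$. For $S\subseteq E(G)$, let $S$ also denote the graph with vertex set $[n]$ and edge set $S$. Then $$\sum_{\substack{S\subseteq E(G)\\ e_i\in S}}(-1)^{|S|}S+(1+t)\sum_{\substack{S\subseteq E(G)\\ e_j\notin S}}(-1)^{|S|}S$$ is a modular relation for $XB$.
   Context: Write $[n]=\{1,\dots,n\}$. A graph is a finite vertex set $V(G)$ together with a finite multiset $E(G)$ of unordered pairs of not necessarily distinct vertices (loops and multi-edges are allowed; parallel copies of an edge are regarded as distinct elements of $E(G)$ when taking subsets $S\subseteq E(G)$). A graph $G$ is two-edge-connected if it is connected and $G-e$ (delete the single edge $e$) is connected for every $e\in E(G)$; equivalently, for each partition of $V(G)$ into two nonempty blocks $B_1,B_2$ there are at least two edges with one endpoint in $B_1$ and the other in $B_2$. $\mathbb{G}$ is the $\mathbb{C}$-vector space freely generated by all (labelled) graphs whose vertex set is $[n]$ for some $n\ge 1$; $\mathbb{G}[t]$ consists of formal linear combinations of such graphs with coefficients in $\mathbb{C}[t]$. Tutte symmetric function: for a graph $G$, $XB_G=\sum_{\kappa}(1+t)^{e(\kappa)}\prod_{v\in V(G)}x_{\kappa(v)}$, where the sum is over all maps $\kappa:V(G)\to\{1,2,3,\dots\}$ and $e(\kappa)$ is the number of edges of $G$ (with multiplicity; every loop is counted) whose endpoints receive the same value under $\kappa$. Extend $\mathbb{C}[t]$-linearly to $XB:\mathbb{G}[t]\to\Lambda[t]$,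 where $\Lambda$ is the algebra of symmetric functions over $\mathbb{C}$ in $x_1,x_2,\dots$. Extension: $G\uplus E$ denotes the graph with vertex set $V(G)$ and edge multiset $E(G)\uplus E$ (multiplicities are added). For $L=\sum_{i} c_i(t)H_i$ with all $H_i$ graphs on $[n]$ and a graph $G'$ on $[N]$, $N\ge n$, set $Ext(L;G')=\sum_i c_i(t)\,(G'\uplus E(H_i))$. Modular relation: a linear combination $L\in\mathbb{G}[t]$ of graphs with vertex set $[n]$ is a modular relation for $XB$ if $Ext(L;G')\in Ker(XB)$ for every $N\ge n$ and every graph $G'$ with vertex set $[N]$. *)

(* Defs.v *)
From mathcomp Require Import all_boot all_order all_algebra finmap multiset.
From mathcomp Require Import boolp classical_sets functions cardinality fsbigop.
From mathcomp Require Import reals complex monalg.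

Set Implicit Arguments.
Unset Strict Implicit.
Unset Printing Implicit Defensive.

Import GRing.Theory.

Local Open Scope ring_scope.
Local Open Scope mset_scope.

(* The unordered pair {u, v} is encoded by its sorted representative; loops are
   the pairs (u, u). *)
Definition upair (n : nat) := {p : 'I_n * 'I_n | (p.1 <= p.2)%N}.

Definition lgraph (n : nat) := {mset upair n}.
Identity Coercion mset_of_lgraph : lgraph >-> multiset_of.

(* The tag n stands for the vertex set [n+1]: vertex sets are nonempty. *)
Definition graph := {n : nat & lgraph n.+1}.

(* The edges of G as individuals: (e, k) is the k-th parallel copy of e. *)
Definition edges (n : nat) (G : lgraph n) := {e : upair n & 'I_(G e)}.

Definition spanning (n : nat) (G : lgraph n) (S : {set edges G}) : lgraph n :=
  seq_mset [seq tag x | x <- enum S].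

Definition adjacent (n : nat) (G : lgraph n) : rel 'I_n := fun u v =>
  [exists e : upair n, (e \in G) && ((val e == (u, v)) || (val e == (v, u)))].

Definition connected (n : nat) (G : lgraph n) : Prop :=
  forall u v : 'I_n, connect (adjacent G) u v.

(* (G `\ e) removes a single copy of e. *)
Definition two_edge_connected (n : nat) (G : lgraph n) : Prop :=
  connected G /\ forall e : upair n, e \in G -> connected (G `\ e : lgraph n).

Definition widen_upair n N (le_nN : (n <= N)%N) (e : upair n) : upair N :=
  exist _ (widen_ord le_nN (val e).1, widen_ord le_nN (val e).2) (valP e).

Definition graph_ext n N (le_nN : (n <= N)%N) (G' : lgraph N) (H : lgraph n) :
    lgraph N :=
  G' `+` seq_mset [seq widen_upair le_nN e | e <- H : {mset _}].

Section Tutte.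
Variable R : realType.

(* The ground field C is R[i], and the parameter t is the polynomial variable. *)
Definition formal_graphs_t := {malg {poly R[i]}[graph]}.

Definition formal_graphs_on_t (n : nat) := {malg {poly R[i]}[lgraph n]}.

(* Formal power series in countably many variables over C[t], given by their
   coefficients; variables and colours are indexed from 0 rather than from 1. *)
Definition power_series_t := {cmonom nat} -> {poly R[i]}.

(* Invariance under permutations of the variables, bounded degree in the
   variables, bounded degree in t. *)
Definition Lambda_t (f : power_series_t) : Prop :=
  [/\ forall (s : nat -> nat) (m m' : {cmonom nat}), bijective s ->
        (forall i, m' (s i) = m i) -> f m' = f m,
      exists d, forall m, (d < mdeg m)%N -> f m = 0 &
      exists d, forall m, (size (f m) <= d)%N].

Definition mono_edges n (G : lgraph n) (k : {ffun 'I_n -> nat}) : nat :=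
  count (fun e : upair n => k (val e).1 == k (val e).2) G.

Definition color_monom n (k : {ffun 'I_n -> nat}) : {cmonom nat} :=
  \big[mmul/mone]_(v < n) ucm (k v).

(* The set summed over is finite (finite_colorings below), so \sum_(_ \in _) is
   the genuine sum. *)
Definition XB_graph n (G : lgraph n) : power_series_t := fun m =>
  \sum_(k \in [set k : {ffun 'I_n -> nat} | color_monom k = m]%classic)
    (1 + 'X : {poly R[i]}) ^+ mono_edges G k.

Definition XB (L : formal_graphs_t) : power_series_t := fun m =>
  \sum_(H <- msupp L) L@_H * XB_graph (tagged H) m.

Lemma color_monomE n (k : {ffun 'I_n -> nat}) i :
  color_monom k i = #|[pred v | k v == i]|.
Proof.
rewrite /color_monom -sum1_card [RHS]big_mkcond /=.
have -> : (\big[mmul/mone]_(v < n) ucm (k v) : {cmonom nat}) i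
          = (\sum_(v < n) (ucm (k v) i))%N.
  by apply: (big_morph (fun m : {cmonom nat} => m i)) => [m1 m2|];
    rewrite ?cmM ?cm1.
by apply: eq_bigr => v _; rewrite ucmE inE; case: eqP.
Qed.

Lemma finite_colorings n (m : {cmonom nat}) :
  finite_set [set k : {ffun 'I_n -> nat} | color_monom k = m]%classic.
Proof.
pose B := (\max_(i <- finsupp m) i)%N.+1.
pose F (f : {ffun 'I_n -> 'I_B}) : {ffun 'I_n -> nat} := [ffun v => f v : nat].
have : finite_set (F @` [set: {ffun 'I_n -> 'I_B}])%classic.
  exact/finite_image/finite_finset.
apply: sub_finite_set => k /= km.
have kB v : (k v < B)%N.
  have kv : k v \in finsupp m.
    rewrite -km mem_finsupp color_monomE -lt0n; apply/card_gt0P.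
    by exists v; rewrite inE.
  by rewrite ltnS; apply: (@leq_bigmax_seq _ _ _ id).
exists [ffun v => Ordinal (kB v)] => //.
by apply/ffunP => v; rewrite !ffunE.
Qed.

Lemma mdeg_color_monom n (k : {ffun 'I_n -> nat}) : mdeg (color_monom k) = n.
Proof.
rewrite mdeg_prod; under eq_bigr do rewrite mdegU.
by rewrite sum1_card card_ord.
Qed.

Lemma XB_graph_Lambda n (G : lgraph n) : Lambda_t (XB_graph G).
Proof.
split.
- move=> s m m' [s' sK s'K] m'm; rewrite /XB_graph.
  pose F (k : {ffun 'I_n -> nat}) : {ffun 'I_n -> nat} := [ffun v => s (k v)].
  pose F' (k : {ffun 'I_n -> nat}) : {ffun 'I_n -> nat} := [ffun v => s' (k v)].
  have FK : cancel F F' by move=> k; apply/ffunP => v; rewrite !ffunE sK.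
  have F'K : cancel F' F by move=> k; apply/ffunP => v; rewrite !ffunE s'K.
  have FE k i : color_monom (F k) (s i) = color_monom k i.
    rewrite !color_monomE; apply: eq_card => v.
    by rewrite !inE ffunE (can_eq sK).
  rewrite (reindex_fsbig F [set k | color_monom k = m]%classic); last first.
    split=> [k /= km|k k' _ _ /(can_inj FK)//|k /= km].
    + apply/eqP/cmP => i; by rewrite -(s'K i) FE m'm km.
    + exists (F' k) => //=; apply/eqP/cmP => i.
      by rewrite -FE F'K km m'm.
  apply: eq_fsbigr => k _; congr (_ ^+ _); apply: eq_count => e.
  by rewrite !ffunE (can_eq sK).
- exists n => m lt_nm; rewrite /XB_graph; apply: fsbig1 => k /= km.
  by move: lt_nm; rewrite -km mdeg_color_monom ltnn.
- exists (size (G : {mset _})).+1 => m; rewrite /XB_graph.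
  rewrite fsbig_finite; last exact: finite_colorings.
  apply: (leq_trans (size_sum _ _ _)); apply/bigmax_leqP_seq => k _ _.
  apply: (leq_trans (size_poly_exp_leq _ _)); rewrite addrC.
  by rewrite -[1]/(1%:P) size_XaddC mul1n ltnS count_size.
Qed.

Lemma XB_Lambda (L : formal_graphs_t) : Lambda_t (XB L).
Proof.
split.
- move=> s m m' s_bij m'm; apply: eq_bigr => H _; congr (_ * _).
  by have [sym _ _] := XB_graph_Lambda (tagged H); apply: sym m'm.
- have /choice[d dP] (H : graph) : exists d, forall m, (d < mdeg m)%N ->
      XB_graph (tagged H) m = 0.
    by have [_ ? _] := XB_graph_Lambda (tagged H).
  exists (\max_(H <- msupp L) d H)%N => m lt_dm; rewrite /XB.
  rewrite big_seq big1 // => H HL; rewrite dP ?mulr0 //.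
  by apply: leq_ltn_trans lt_dm; apply: (@leq_bigmax_seq _ _ _ d).
- have /choice[d dP] (H : graph) : exists d, forall m,
      (size (XB_graph (tagged H) m) <= d)%N.
    by have [_ _ ?] := XB_graph_Lambda (tagged H).
  exists (\max_(H <- msupp L) (size L@_H + d H))%N => m; rewrite /XB.
  apply: (leq_trans (size_sum _ _ _)); apply/bigmax_leqP_seq => H HL _.
  have := @leq_bigmax_seq _ _ _ (fun H => size L@_H + d H)%N H HL isT.
  apply: leq_trans; apply: (leq_trans (size_polyMleq _ _)).
  by apply: (leq_trans (leq_pred _)); rewrite leq_add2l.
Qed.

Definition ker_XB (L : formal_graphs_t) : Prop := forall m, XB L m = 0.

Definition Ext n N (le_nN : (n <= N)%N) (L : formal_graphs_on_t n.+1)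
    (G' : lgraph N.+1) : formal_graphs_t :=
  \sum_(H <- msupp L)
    << L@_H *g (Tagged (fun k => lgraph k.+1) (@graph_ext n.+1 N.+1 le_nN G' H) : graph) >>.

Definition modular_relation n (L : formal_graphs_on_t n.+1) : Prop :=
  forall N (le_nN : (n <= N)%N) (G' : lgraph N.+1), ker_XB (Ext le_nN L G').

End Tutte.

(* Main.v *)
Require Import Defs.
From mathcomp Require Import all_boot all_order all_algebra finmap multiset.
From mathcomp Require Import reals complex monalg.
From mathcomp Require fsbigop.

(* Evaluated at a colouring k of the vertices, the first sum factors as
   - q^[e_i is monochromatic] \prod_(e != e_i) (1 - q^[e is monochromatic]) with
   q = 1 + t, and the second one as q \prod_(e != e_j) (1 - q^[...]).  Either
   product vanishes unless all edges but one are monochromatic, and as G minus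
   one edge is connected this forces k to be constant; then every edge is
   monochromatic and the two terms cancel. *)

Set Implicit Arguments.
Unset Strict Implicit.
Unset Printing Implicit Defensive.

Import GRing.Theory.
Local Open Scope ring_scope.

Section SubsetSums.
Variables (A : comNzRingType) (T : finType) (a : T -> A) (i0 : T).

(** Expand [\prod_i (- a i + G i)] over subsets, with [G] equal to 1 except for a 0 at [i0]: this
    zero kills exactly the sets that omit [i0]. *)
Lemma sum_sign_prod_in :
  \sum_(S : {set T} | i0 \in S) (-1) ^+ #|S| * \prod_(i in S) a i
    = - a i0 * \prod_(i | i != i0) (1 - a i).
Proof.
pose F i := - a i; pose G i : A := (i != i0)%:R.
transitivity (\prod_i (F i + G i)); last first.
  rewrite (bigD1 i0) //= /G eqxx addr0; congr (_ * _).
  by apply: eq_bigr => i ->; rewrite addrC.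
rewrite bigA_distr big_mkcond; apply: eq_bigr => S _.
case: ifP => [i0S|/negbT i0S]; last first.
  by rewrite (bigD1 i0) //= (negPf i0S) /G eqxx mul0r.
rewrite -prodrN big_mkcond; apply: eq_bigr => i _.
case: ifPn => // iS; rewrite /G.
by case: eqVneq iS => // ->; rewrite i0S.
Qed.

Lemma sum_sign_prod_notin :
  \sum_(S : {set T} | i0 \notin S) (-1) ^+ #|S| * \prod_(i in S) a i
    = \prod_(i | i != i0) (1 - a i).
Proof.
(* Now the zero sits in the other summand, so the sets containing [i0] are killed. *)
pose F i := if i == i0 then 0 else - a i.
transitivity (\prod_i (F i + 1)); last first.
  rewrite (bigD1 i0) //= /F eqxx add0r mul1r.
  by apply: eq_bigr => i /negPf ->; rewrite addrC.
rewrite bigA_distr big_mkcond; apply: eq_bigr => S _.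
case: ifPn => [i0S|]; last first.
  by rewrite negbK => i0S; rewrite (bigD1 i0) //= i0S /F eqxx mul0r.
rewrite -prodrN big_mkcond; apply: eq_bigr => i _.
case: ifPn => // iS; rewrite /F.
by case: eqVneq iS => // ->; rewrite (negPf i0S).
Qed.

End SubsetSums.

(** The hypothesis on [p] is all that two-edge-connectedness contributes: no element can be the only
    one to fail [p]. *)
Lemma sum_sign_exp_cancel (A : comNzRingType) (T : finType) (q : A)
    (p : pred T) (i j : T) :
  (forall x, (forall y, y != x -> p y) -> forall y, p y) ->
  \sum_(S : {set T} | i \in S) (-1) ^+ #|S| * \prod_(y in S) q ^+ p y
    + q * \sum_(S : {set T} | j \notin S)
        (-1) ^+ #|S| * \prod_(y in S) q ^+ p y = 0.
Proof.
move=> p_all; rewrite sum_sign_prod_in sum_sign_prod_notin.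
have [/forallP pT|/forallPn[y0 py0]] := boolP [forall y, p y].
  (* The value does not depend on the omitted element, so [i] and [j] may differ. *)
  have PE x : \prod_(y | y != x) (1 - q ^+ p y) = (1 - q) ^+ #|T|.-1.
    rewrite (eq_bigr (fun=> 1 - q)) => [|y _]; last by rewrite pT.
    by rewrite prodr_const cardC1.
  by rewrite !PE pT mulNr addNr.
(* Since [y0] fails [p], some [y != x] fails it too, and its factor is [1 - q ^+ 0 = 0]. *)
suff P0 x : \prod_(y | y != x) (1 - q ^+ p y) = 0 by rewrite !P0 !mulr0 addr0.
have [/forall_inP px|] := boolP [forall (y | y != x), p y].
  by rewrite (p_all x px) in py0.
rewrite negb_forall_in => /exists_inP[y yx /negPf py].
by rewrite (bigD1 y) //= py subrr mul0r.
Qed.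

Lemma mmap_idfunZ (K : choiceType) (A : nzRingType) (h : K -> A) (c : A)
    (L : {malg A[K]}) :
  mmap idfun h (c *: L) = c * mmap idfun h L.
Proof.
rewrite (mmapEw (msuppZ_le c L)) mmapE big_distrr /=.
by apply: eq_bigr => x _; rewrite mcoeffZ mulrA.
Qed.

Section Colourings.
Variable n : nat.
Implicit Types (G H : lgraph n) (k : {ffun 'I_n -> nat}).

Definition mono k (e : upair n) := k (val e).1 == k (val e).2.

Lemma mono_edges_ext N (le_nN : (n <= N)%N) (G' : lgraph N) H
    (k : {ffun 'I_N -> nat}) :
  mono_edges (graph_ext le_nN G' H) k
    = (mono_edges G' k + mono_edges H [ffun v => k (widen_ord le_nN v)])%N.
Proof.
rewrite /mono_edges /graph_ext.
set s := [seq _ | e <- _]; set p := (fun e : upair N => _).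
have /permP -> : perm_eq (G' `+` seq_mset s)%mset (enum_mset G' ++ s).
  apply/eq_seq_msetP; rewrite seq_mset_id; apply/msetP => e.
  by rewrite msetE2 !mset_seqE count_cat count_mem_mset.
rewrite count_cat count_map; congr addn; apply: eq_count => e.
by rewrite /= !ffunE.
Qed.

Lemma exp_mono_edges_spanning (A : comNzRingType) (q : A) G
    (S : {set edges G}) k :
  q ^+ mono_edges (spanning S) k = \prod_(e in S) q ^+ mono k (tag e).
Proof.
rewrite /mono_edges /spanning (permP (perm_eq_seq_mset _)) count_map.
rewrite -sum1_count big_mkcond expr_sum.
by rewrite big_enum.
Qed.

(** Removing one copy of [tag x] leaves a connected graph whose edges are all monochromatic, so [k]
    is constant along its paths. *)
Lemma mono_constant G (x : edges G) k :
  two_edge_connected G -> (forall e : edges G, e != x -> mono k (tag e)) ->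
  forall u v, k u = k v.
Proof.
move=> [_ conn] mono_k u v.
have xG : tag x \in G by rewrite in_mset; case: (tagged x) => i; case: (G _).
have mono_D e : e \in (G `\ tag x)%mset -> mono k e.
  rewrite in_msetB1 in_mset => /andP[/implyP Gx1 eG].
  (* A surviving pair has a copy other than [x]: if it is [tag x] itself, its multiplicity is at
     least 2, and copy 0 or copy 1 will do. *)
  have [j jx] : exists j : 'I_(G e), Tagged (fun e => 'I_(G e)) j != x.
    have [/eqP/Gx1 Ge1|ex] := eqVneq e (tag x); last first.
      by exists (Ordinal eG); apply: contra_neq ex => <-.
    have [|] := eqVneq (Tagged (fun e => 'I_(G e)) (Ordinal eG)) x.
      move=> <-; exists (Ordinal Ge1).
      by rewrite eq_Tagged.
    by exists (Ordinal eG).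
  exact: mono_k _ jx.
have /connectP[p] := conn _ xG u v.
elim: p u => [|w p IHp] u /=; first by move=> _ ->.
move=> /andP[/existsP[e /andP[/mono_D]]].
rewrite /mono => /eqP ke e_uw wp /(IHp _ wp) <-.
by case/orP: e_uw ke => /eqP -> /=.
Qed.

Lemma sum_spanning_mono (A : comNzRingType) (q : A) G (ei ej : edges G) k :
  two_edge_connected G ->
  \sum_(S : {set edges G} | ei \in S)
      (-1) ^+ #|S| * q ^+ mono_edges (spanning S) k
    + q * \sum_(S : {set edges G} | ej \notin S)
      (-1) ^+ #|S| * q ^+ mono_edges (spanning S) k = 0.
Proof.
move=> hG; under eq_bigr do rewrite exp_mono_edges_spanning.
under [X in _ + _ * X]eq_bigr do rewrite exp_mono_edges_spanning.
apply: (sum_sign_exp_cancel q (p := fun e => mono k (tag e))) => x mono_x e.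
exact/eqP/(mono_constant hG mono_x).
Qed.

End Colourings.

(** [XB] is by conversion the linear extension [mmap idfun], so the support of [Ext] never has to be
    determined. *)
Lemma XB_Ext (R : realType) n N (le_nN : (n <= N)%N)
    (L : formal_graphs_on_t R n.+1) (G' : lgraph N.+1) m :
  XB (Ext le_nN L G') m
    = mmap idfun (fun H => XB_graph R (graph_ext (le_nN : n < N.+1)%N G' H) m) L.
Proof.
rewrite -[LHS]/(mmap idfun (fun H : graph => XB_graph R (tagged H) m) _).
by rewrite raddf_sum; apply: eq_bigr => H _; exact: mmapU.
Qed.

Theorem theorem13 (R : realType) (n : nat) (G : lgraph n.+1)
    (ei ej : edges G) (hG : two_edge_connected G) :
  modular_relation (R := R)
    (\sum_(S : {set edges G} | ei \in S) (-1) ^+ #|S| *: << spanning S >>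
     + (1 + 'X) *:
       (\sum_(S : {set edges G} | ej \notin S) (-1) ^+ #|S| *: << spanning S >>)).
Proof.
move=> N le_nN G' m; rewrite XB_Ext raddfD /= mmap_idfunZ !raddf_sum /=.
under eq_bigr do rewrite mmap_idfunZ mmapU mul1r.
under [X in _ + _ * X]eq_bigr do rewrite mmap_idfunZ mmapU mul1r.
rewrite /XB_graph; under eq_bigr do
  rewrite (fsbigop.fsbig_finite _ _ (finite_colorings _ m)) big_distrr.
under [X in _ + _ * X]eq_bigr do
  rewrite (fsbigop.fsbig_finite _ _ (finite_colorings _ m)) big_distrr.
(* With the colouring sums outermost, the identity is checked one colouring at a time. *)
rewrite exchange_big [X in _ + _ * X]exchange_big big_distrr -big_split.
apply: big1 => k _ /=; set q := 1 + 'X.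
(* The edges of [G'] give a factor independent of [S]; what remains concerns [k] restricted to the
   vertices of [G]. *)
under eq_bigr do rewrite mono_edges_ext exprD mulrCA.
under [X in _ + _ * X]eq_bigr do rewrite mono_edges_ext exprD mulrCA.
by rewrite -!big_distrr /= mulrCA -mulrDr sum_spanning_mono // mulr0.
Qed.
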